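(* Let $k\ge 3$ be an integer, $X$ a finite connected poset and $F$ a field admitting a primitive $(k-1)$-th root of unity with $\mathrm{char}(F)\nmid k$. Then every bijective $F$-linear map $\varphi:I(X,F)\to I(X,F)$ with $\varphi(P_k(I(X,F)))\subseteq P_k(I(X,F))$ is of the form $\varphi=r\psi$, where $r\in F$ satisfies $r^{k-1}=1$ and $\psi$ is either an automorphism or an anti-automorphism of $I(X,F)$.
   Context: $I(X,F)$ is the incidence algebra of the locally finite poset $X$ over $F$ (functions $f:X\times X\to F$ vanishing unless $x\le y$, with product $(fg)(x,y)=\sum_{x\le z\le y}f(x,z)g(z,y)$). A poset is connected if any two elements are joined by a finite sequence of elements in which consecutive elements are comparable. $P_k(A)=\{a: a^k=a\}$ is the set of $k$-potents. *)

(* Defs.v *)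
From HB Require Import structures.
From mathcomp Require Import all_boot all_order all_algebra.
Set Implicit Arguments. Unset Strict Implicit. Unset Printing Implicit Defensive.
Import GRing.Theory.
Local Open Scope ring_scope.

(* Elements of the incidence algebra I(X,F) of a finite poset (T, le) are
   represented as finite functions on T * T vanishing off the order relation. *)
Section Incidence.
Variables (T : finType) (le : rel T) (F : fieldType).

Definition is_poset : Prop :=
  [/\ reflexive le, antisymmetric le & transitive le].

Definition poset_connected : Prop :=
  forall x y : T, connect (fun a b => le a b || le b a) x y.

Definition incid (f : {ffun T * T -> F}) : bool :=
  [forall x, forall y, ~~ le x y ==> (f (x, y) == 0)].

Definition imul (f g : {ffun T * T -> F}) : {ffun T * T -> F} :=
  [ffun p => \sum_(z | le p.1 z && le z p.2) f (p.1, z) * g (z, p.2)].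

Definition ione : {ffun T * T -> F} := [ffun p => (p.1 == p.2)%:R].

Definition ipow (f : {ffun T * T -> F}) (n : nat) : {ffun T * T -> F} :=
  iter n (imul f) ione.

Definition kpotent (k : nat) (f : {ffun T * T -> F}) : bool :=
  incid f && (ipow f k == f).

Definition iscale (a : F) (f : {ffun T * T -> F}) : {ffun T * T -> F} :=
  [ffun p => a * f p].

Definition ilinear (phi : {ffun T * T -> F} -> {ffun T * T -> F}) : Prop :=
  (forall f, incid f -> incid (phi f)) /\
  (forall (a : F) f g, incid f -> incid g -> phi (iscale a f + g) = iscale a (phi f) + phi g).

Definition ibijective (phi : {ffun T * T -> F} -> {ffun T * T -> F}) : Prop :=
  {in incid &, injective phi} /\
  (forall g, incid g -> exists2 f, incid f & phi f = g).

Definition iautomorphism (psi : {ffun T * T -> F} -> {ffun T * T -> F}) : Prop :=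
  [/\ ilinear psi, ibijective psi, psi ione = ione &
      forall f g, incid f -> incid g -> psi (imul f g) = imul (psi f) (psi g)].

Definition iantiautomorphism (psi : {ffun T * T -> F} -> {ffun T * T -> F}) : Prop :=
  [/\ ilinear psi, ibijective psi, psi ione = ione &
      forall f g, incid f -> incid g -> psi (imul f g) = imul (psi g) (psi f)].

End Incidence.

(* Main.v *)
Require Import Defs.
From HB Require Import structures.
From mathcomp Require Import all_boot all_order all_algebra.
Set Implicit Arguments. Unset Strict Implicit. Unset Printing Implicit Defensive.
Import GRing.Theory.
Local Open Scope ring_scope.

(** Let a, b be images of orthogonal idempotents. Then a + t b is k-potent for
    t = 0 and for every (k-1)-th root of unity t; comparing coefficients in t,
    the sum S of all words of length k with exactly one letter b vanishes.
    From a S - S a = a^k b - b a^k the elements a and b commute, so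
    0 = S = k a^(k-1) b and ab = 0. Applied to e and 1 - e this gives
    phi(e) phi(1) = phi(e)^2 = phi(1) phi(e); since the idempotents span I(X,F),
    phi(1) is central, hence a scalar r, and psi = r^-1 phi preserves idempotents.

    Composing psi with an inner automorphism, psi(e_xx) = e_(lx,lx) for a
    permutation l of X. Then psi(e_xy) is a nonzero multiple of e_(lx,ly) or of
    e_(ly,lx), so l preserves comparability in both directions, and the Jordan
    relation for e_xy, e_yz shows that it preserves betweenness. On a connected
    poset such an l is monotone or antitone. *)

(** * Roots of unity in a field *)

(** If the characteristic p divided n, injectivity of the Frobenius map would already give
    [w ^+ (n %/ p) = 1], against primitivity. *)
Lemma prim_root_natf_neq0 (F : fieldType) n (w : F) :
  n.-primitive_root w -> n%:R != 0 :> F.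
Proof.
move=> prim_w; have n_gt0 := prim_order_gt0 prim_w.
apply/negP => /[dup] n0 /(natf0_pchar n_gt0) [p pcharFp].
have p_dv_n : (p %| n)%N by rewrite (dvdn_pcharf pcharFp).
have p_pr := pcharf_prime pcharFp.
have : w ^+ (n %/ p) = 1.
  apply: (fmorph_inj (pFrobenius_aut pcharFp)).
  by rewrite rmorph1 /= pFrobenius_autE -exprM divnK // prim_expr_order.
move/eqP; rewrite -(prim_order_dvd prim_w) gtnNdvd //.
  by rewrite divn_gt0 ?prime_gt0 // dvdn_leq.
by rewrite ltn_Pdiv // prime_gt1.
Qed.

(** Read as a geometric sum of ratio [w ^+ j]: multiplied by [w ^+ j - 1] it telescopes to zero. *)
Lemma sum_prim_root (F : fieldType) n (w : F) (j : nat) : n.-primitive_root w ->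
  \sum_(i < n) (w ^+ i) ^+ j = if (n %| j)%N then n%:R else 0.
Proof.
move=> prim_w; have -> : \sum_(i < n) (w ^+ i) ^+ j = \sum_(i < n) (w ^+ j) ^+ i.
  by apply: eq_bigr => i _; rewrite exprAC.
rewrite (prim_order_dvd prim_w); case: ifP => [/eqP-> | wj1].
  by rewrite (eq_bigr (fun=> 1)) ?sumr_const ?card_ord // => i _; rewrite expr1n.
apply: (@mulfI _ (w ^+ j - 1)); first by rewrite subr_eq0 wj1.
by rewrite -subrX1 mulr0 exprAC (prim_expr_order prim_w) expr1n subrr.
Qed.

(** * Words in two letters and pencils of k-potents *)

Section Words.
Variables (F : fieldType) (A : algType F).
Implicit Types a b : A.

(* The sum of all words of length [m] in [a] and [b] containing [j] letters [b]. *)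
Fixpoint words a b (m j : nat) : A :=
  if m is m'.+1 then
    a * words a b m' j + (if j is j'.+1 then b * words a b m' j' else 0)
  else (j == 0)%:R.

Lemma words_gt a b m j : (m < j)%N -> words a b m j = 0.
Proof.
elim: m j => [|m IH] [|j] //= lt_mj.
by rewrite !IH ?mulr0 ?addr0 // ltnW.
Qed.

Lemma words0 a b m : words a b m 0 = a ^+ m.
Proof. by elim: m => [|m IH] //=; rewrite IH addr0 exprS. Qed.

Lemma words_diag a b m : words a b m m = b ^+ m.
Proof. by elim: m => [|m IH] //=; rewrite IH words_gt // mulr0 add0r exprS. Qed.

Lemma exprD_words a b (t : F) m :
  (a + t *: b) ^+ m = \sum_(j < m.+1) t ^+ j *: words a b m j.
Proof.
elim: m => [|m IH]; first by rewrite big_ord1 /= scale1r.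
rewrite exprS IH mulrDl [in RHS]big_ord_recl /= addr0.
under [in RHS]eq_bigr do rewrite scalerDr.
rewrite big_split /= addrA; congr (_ + _).
  rewrite mulr_sumr big_ord_recl /= scalerAr; congr (_ + _).
  rewrite big_ord_recr /= words_gt // mulr0 scaler0 addr0.
  by apply: eq_bigr => i _; rewrite /= scalerAr.
rewrite mulr_sumr; apply: eq_bigr => i _.
by rewrite /bump /= exprS -scalerAr -scalerAl scalerA mulrC.
Qed.

(** The definition splits off the first letter of a word, this lemma the last one. Equating the two
    expresses the commutator of [a] with the one-[b] words through [a ^+ m] and [b]. *)
Lemma words1_comm a b m :
  words a b m.+1 1 = words a b m 1 * a + a ^+ m * b.
Proof.
elim: m => [|m IH]; first by rewrite /= mulr0 mul0r mul1r mulr1.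
have S1 i : words a b i.+1 1 = a * words a b i 1 + b * a ^+ i by rewrite /= words0.
rewrite S1 {1}IH S1 mulrDr mulrDl !mulrA -exprS addrAC; congr (_ + _ + _).
by rewrite -mulrA -exprSr.
Qed.

Lemma words1_mul a b m : a * b = b * a -> words a b m.+1 1 = (a ^+ m * b) *+ m.+1.
Proof.
move=> cab; elim: m => [|m IH]; first by rewrite /= mulr0 add0r mul1r mulr1.
rewrite [LHS]/= -/(words a b m.+1 1) -/(words a b m.+1 0) IH mulrnAr mulrA -exprS.
by rewrite words0 (commrX m.+1 (esym cab)) addrC -mulrS.
Qed.

Lemma kpotent_pencil_mul0 k (w : F) a b : (3 <= k)%N ->
  k.-1.-primitive_root w -> k%:R != 0 :> F -> a ^+ k = a -> b ^+ k = b ->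
  (forall t : F, t ^+ k.-1 = 1 -> (a + t *: b) ^+ k = a + t *: b) ->
  a * b = 0 /\ b * a = 0.
Proof.
case: k => [|[|[|m]]] // _; set n := m.+2 => /= prim_w k_neq0 ak bk abk0.
have abk (t : F) : t ^+ n = 1 -> (a + t *: b) ^+ n.+1 = a + t *: b := abk0 t.
have wn : w ^+ n = 1 := prim_expr_order prim_w.
have nF : n%:R != 0 :> F by apply: prim_root_natf_neq0 prim_w.
have S1 : words a b n.+1 1 = 0.
  (* The weight is the power n - 1 of the root, so averaging over all n-th roots of unity picks out
     the coefficients of t^j with j = 1 mod n. On the k-potent side only [b] is left. *)
  have avg : \sum_(i < n) (w ^+ i) ^+ m.+1 *: (a + w ^+ i *: b) ^+ n.+1 = n%:R *: b.
    under eq_bigr => i _.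
      rewrite abk; last by rewrite exprAC wn expr1n.
      rewrite scalerDr scalerA -exprSr -/n [_ ^+ n]exprAC wn expr1n.
      over.
    rewrite big_split /= -scaler_suml (sum_prim_root _ prim_w) gtnNdvd //.
    by rewrite scale0r add0r -scaler_suml sumr_const card_ord.
  have Wdiag := words_diag a b n.+1; rewrite bk in Wdiag.
  have Wexp t := exprD_words a b t n.+1.
  move: (words a b n.+1) Wdiag Wexp => W Wdiag Wexp.
  (* On the expanded side j runs from 0 to n + 1, so exactly j = 1 and j = n + 1 survive; the latter
     contributes [b ^+ k = b], which cancels. *)
  have : n%:R *: b = n%:R *: (W 1 + b).
    rewrite -{1}avg; under eq_bigr do rewrite Wexp scaler_sumr.
    rewrite exchange_big /=.
    under eq_bigr => j _.
      under eq_bigr do rewrite scalerA -exprD.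
      rewrite -scaler_suml (sum_prim_root _ prim_w).
      over.
    rewrite 2!big_ord_recl big_ord_recr /= /bump /= addn0 addn1 dvdnn.
    rewrite gtnNdvd // scale0r add0r scalerDr; congr (_ + _).
    rewrite big1 ?add0r => [|i _].
      by rewrite -[(1 + (1 + m.+1))%N]/n.+1 Wdiag addnS -addSn dvdn_addl ?dvdnn.
    by rewrite !add1n addnS -addSn dvdn_addr // gtnNdvd ?scale0r //= ltnS.
  by move/(scalerI nF)/eqP; rewrite -{1}[b]add0r (inj_eq (addIr _)) => /eqP.
(* Words of length k + 1 with one [b] are split at the first and at the last letter. Both inner
   one-[b] sums vanish by [S1], which leaves [b * a ^+ k] and [a ^+ k * b]. *)
have cab : a * b = b * a.
  have := words1_comm a b n.+1; rewrite (_ : words _ _ _ _ =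
    a * words a b n.+1 1 + b * words a b n.+1 0) //.
  by rewrite S1 words0 ak mulr0 mul0r !add0r.
have ab0 : a * b = 0.
  have := words1_mul n cab; rewrite S1 -scaler_nat => /esym/eqP.
  rewrite scaler_eq0 (negPf k_neq0) /= => /eqP anb.
  by rewrite -ak exprS -mulrA anb mulr0.
by rewrite -cab ab0.
Qed.

End Words.

(** * Separating even and odd parts when 2 is invertible *)

Section TwoInvertible.
Variables (F : fieldType) (A : algType F).
Hypothesis two_neq0 : 2%:R != 0 :> F.

Lemma eq_of_double (a b : A) : a + a = b + b -> a = b.
Proof. by rewrite -!mulr2n -!scaler_nat => /(scalerI two_neq0). Qed.

(** With P = aa + bb and Q = ab + ba the hypotheses read P + Q = a + b and P - Q = a - b; half their
    sum and half their difference are the claim. *)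
Lemma idem_addsub (a b : A) :
  (a + b) * (a + b) = a + b -> (a - b) * (a - b) = a - b ->
  a * a + b * b = a /\ a * b + b * a = b.
Proof.
rewrite !mulrDl !mulrDr !mulrN !mulNr opprK.
rewrite [b * a + _]addrC addrACA [- (b * a) + _]addrC [X in _ -> X = _ -> _]addrACA -opprD.
move: (a * a + b * b) (a * b + b * a) => P Q h1 h2.
split; apply: eq_of_double.
  transitivity ((P + Q) + (P - Q)); first by rewrite addrACA subrr addr0.
  by rewrite h1 h2 addrACA subrr addr0.
transitivity ((P + Q) - (P - Q)); first by rewrite opprB [RHS]addrC addrA subrK.
by rewrite h1 h2 opprB addrC addrA subrK.
Qed.
End TwoInvertible.

(** * Incidence matrices *)

Section IncidenceMatrices.
Variables (F : fieldType) (n : nat) (le : rel 'I_n.+1).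
Local Notation M := 'M[F]_n.+1.
Local Notation E := (@delta_mx F n.+1 n.+1).
Implicit Types A B : M.

(** The incidence algebra is kept as a predicate on full matrices, so that products and linear maps
    are those of the matrix algebra. *)
Definition incmx A := forall i j, ~~ le i j -> A i j = 0.

Lemma mulmx_entry A B i j : (A * B) i j = \sum_l A i l * B l j.
Proof. by rewrite -mulmxE mxE. Qed.

Lemma mul_mx_deltaE A i j a b : (A * E i j) a b = A a i *+ (b == j).
Proof.
rewrite mulmx_entry (bigD1 i) //= mxE eqxx /= mulr_natr big1 ?addr0 // => l li.
by rewrite mxE (negPf li) mulr0.
Qed.

Lemma mul_delta_mxE A i j a b : (E i j * A) a b = A j b *+ (a == i).
Proof.
rewrite mulmx_entry (bigD1 j) //= mxE eqxx andbT mulr_natl big1 ?addr0 // => l lj.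
by rewrite mxE (negPf lj) andbF mul0r.
Qed.

Lemma mul_deltas i j k l : E i j * E k l = E i l *+ (j == k).
Proof. by rewrite -mulmxE mul_delta_mx_cond. Qed.

Lemma incmxD A B : incmx A -> incmx B -> incmx (A + B).
Proof. by move=> hA hB i j nle; rewrite mxE hA ?hB ?addr0. Qed.

Lemma incmxZ (c : F) A : incmx A -> incmx (c *: A).
Proof. by move=> hA i j nle; rewrite mxE hA ?mulr0. Qed.

Lemma incmxB A B : incmx A -> incmx B -> incmx (A - B).
Proof. by move=> hA hB i j nle; rewrite !mxE hA ?hB ?subr0. Qed.

Lemma incmx_delta i j : le i j -> incmx (E i j).
Proof.
move=> le_ij a b; rewrite mxE; case: eqP => [->|//]; case: eqP => [->|//].
by rewrite le_ij.
Qed.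

Lemma incmx_sum (I : finType) (f : I -> M) :
  (forall i, incmx (f i)) -> incmx (\sum_i f i).
Proof. by move=> hf i j nle; rewrite summxE big1 // => x _; rewrite hf. Qed.

Lemma incmx_sum_delta A : incmx A ->
  A = \sum_i \sum_(j | le i j) A i j *: E i j.
Proof.
move=> hA; rewrite {1}[A]matrix_sum_delta; apply: eq_bigr => i _.
rewrite [RHS]big_mkcond; apply: eq_bigr => j _.
by case: ifPn => // nle; rewrite hA ?scale0r.
Qed.

Hypothesis le_poset : is_poset le.

Lemma incmxM A B : incmx A -> incmx B -> incmx (A * B).
Proof.
case: le_poset => _ _ tr hA hB i j nle; rewrite mulmx_entry big1 // => l _.
have [il | /hA-> ] := boolP (le i l); last by rewrite mul0r.
have [lj | /hB-> ] := boolP (le l j); last by rewrite mulr0.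
by rewrite (tr _ _ _ il lj) in nle.
Qed.

Lemma incmx1 : incmx 1.
Proof.
case: le_poset => refl _ _ i j; rewrite mxE; case: eqP => // ->.
by rewrite refl.
Qed.

Lemma incmx_mul_diag A B i : incmx A -> incmx B -> (A * B) i i = A i i * B i i.
Proof.
case: le_poset => _ anti _ hA hB.
rewrite mulmx_entry (bigD1 i) //= big1 ?addr0 // => l li.
have [il | /hA-> ] := boolP (le i l); last by rewrite mul0r.
have [lj | /hB-> ] := boolP (le l i); last by rewrite mulr0.
by rewrite (anti l i) ?eqxx ?il ?lj in li.
Qed.

(** Such a matrix is strictly triangular, so an idempotent one vanishes. The induction is on the
    size of the interval from i to j: in the sum for [A i j] the term at l = j has a diagonal
    factor, and any other l gives a smaller interval from i to l. *)
Lemma incmx_idem_diag0 A : incmx A -> A * A = A -> (forall i, A i i = 0) -> A = 0.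
Proof.
case: le_poset => refl anti tr hA idA diagA; apply/matrixP => i j; rewrite mxE.
have [m] := ubnP #|[pred l | le i l && le l j]|.
elim: m i j => // m IH i j lt_m.
have [le_ij | /hA //] := boolP (le i j).
rewrite -idA mulmx_entry big1 // => l _.
have [-> | lj] := eqVneq l j; first by rewrite diagA mulr0.
have [le_il | /hA-> ] := boolP (le i l); last by rewrite mul0r.
have [le_lj | /hA-> ] := boolP (le l j); last by rewrite mulr0.
rewrite (IH i l) ?mul0r //.
rewrite ltnS in lt_m; apply: leq_trans lt_m; apply/proper_card/properP; split.
  by apply/subsetP => x; rewrite !inE => /andP[-> xl]; apply: tr le_lj.
exists j; rewrite !inE ?le_ij ?refl //=.
by apply: contra lj => jl; rewrite (anti l j) ?le_lj.
Qed.

End IncidenceMatrices.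

(** * Orders with the same comparability graph and betweenness *)

Section ComparabilityOrientation.
Variables (T : finType).
Implicit Types le : rel T.

(** Betweenness of the middle element, in a form invariant under reversing [le2]; this reduces the
    antitone case to the monotone one. *)
Definition same_between (le1 le2 : rel T) := forall x y z,
  le1 x y -> le1 y z -> x != y -> y != z ->
  le2 x y = le2 y z /\ le2 y x = le2 z y.

(** An edge below x forms a chain with xy, where betweenness applies directly. If an edge from x up
    to z were reversed, then z, x, y would ascend in [le2], so y and z would be comparable; in
    either [le1]-order of y and z, betweenness contradicts antisymmetry. *)
Lemma mono_at_vertex (le1 le2 : rel T) x y :
  is_poset le1 -> is_poset le2 ->
  (forall a b, le1 a b || le1 b a = le2 a b || le2 b a) -> same_between le1 le2 ->
  x != y -> le1 x y -> le2 x y ->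
  forall z, (le1 x z -> le2 x z) /\ (le1 z x -> le2 z x).
Proof.
move=> [refl1 anti1 tr1] [refl2 anti2 tr2] cmp btw xy le1xy le2xy z.
have [<-|xz] := eqVneq x z; first by rewrite refl2.
have [<-|yz] := eqVneq y z.
  split=> // le1yx; case/eqP: xy; apply: anti1; by rewrite le1xy.
split=> [le1xz|le1zx]; last by have [-> _] := btw z x y le1zx le1xy ltac:(by rewrite eq_sym) xy.
have := cmp x z; rewrite le1xz => /esym/orP[//|le2zx].
have le2zy := tr2 _ _ _ le2zx le2xy.
have := cmp z y; rewrite le2zy => /orP[le1zy|le1yz].
- have [_ /esym] := btw x z y le1xz le1zy xz ltac:(by rewrite eq_sym).
  by rewrite le2zx => le2yz; case/eqP: yz; apply: anti2; rewrite le2zy le2yz.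
- have [/esym le2yz _] := btw x y z le1xy le1yz xy yz.
  by rewrite le2xy in le2yz; case/eqP: yz; apply: anti2; rewrite le2zy le2yz.
Qed.

Definition rev_rel (le : rel T) : rel T := fun x y => le y x.

Lemma rev_poset le : is_poset le -> is_poset (rev_rel le).
Proof.
case=> refl anti tr; split; first exact: refl.
  by move=> x y /andP[yx xy]; apply: anti; rewrite /rev_rel in yx xy; rewrite xy.
by move=> y x z yx zy; apply: tr zy yx.
Qed.

Lemma mono_of_edge (le1 le2 : rel T) x y :
  is_poset le1 -> is_poset le2 -> poset_connected le1 ->
  (forall a b, le1 a b || le1 b a = le2 a b || le2 b a) -> same_between le1 le2 ->
  x != y -> le1 x y -> le2 x y ->
  forall a b, le1 a b -> le2 a b.
Proof.
move=> po1 po2 conn cmp btw xy le1xy le2xy a b.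
suff /(_ b) [] : forall b, (le1 a b -> le2 a b) /\ (le1 b a -> le2 b a) by [].
have /connectP [p] := conn x a.
have := mono_at_vertex po1 po2 cmp btw xy le1xy le2xy.
elim: p {y xy le1xy le2xy} x => [|c p IH] x mono_x /=; first by move=> _ ->.
case/andP=> xc path_p last_p; apply: (IH c) => //.
have [<-//|] := eqVneq x c; rewrite eq_sym => cx.
case/orP: xc => xc.
  (* Here c is the upper end of the edge just traversed, while [mono_at_vertex] starts from a lower
     end, so both orders are reversed. *)
  have := @mono_at_vertex (rev_rel le1) (rev_rel le2) c x (rev_poset po1) (rev_poset po2).
  move=> H z; have [] := H _ _ cx xc ((mono_x c).1 xc) z; rewrite /rev_rel => //.
  move=> u v w vu wv uv vw.
  by have [-> ->] := btw w v u wv vu ltac:(by rewrite eq_sym) ltac:(by rewrite eq_sym).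
exact: (mono_at_vertex po1 po2 cmp btw cx xc ((mono_x c).2 xc)).
Qed.

Lemma mono_or_anti (le1 le2 : rel T) :
  is_poset le1 -> is_poset le2 -> poset_connected le1 ->
  (forall a b, le1 a b || le1 b a = le2 a b || le2 b a) -> same_between le1 le2 ->
  (forall a b, le1 a b -> le2 a b) \/ (forall a b, le1 a b -> le2 b a).
Proof.
move=> po1 po2 conn cmp btw.
have [/existsP[x /existsP[y /andP[xy le1xy]]]|] :=
  boolP [exists x, exists y, (x != y) && le1 x y]; last first.
  (* In an antichain [le1] is equality, and reflexivity of [le2] suffices. *)
  rewrite negb_exists => /forallP none; left=> a b le1ab.
  have := none a; rewrite negb_exists => /forallP/(_ b).
  by rewrite le1ab andbT negbK => /eqP->; case: po2.
have := cmp x y; rewrite le1xy => /esym/orP[le2xy|le2yx]; [left|right].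
  exact: (mono_of_edge po1 po2 conn cmp btw xy le1xy le2xy).
apply: (@mono_of_edge le1 (rev_rel le2) x y) => //.
- exact: rev_poset.
- by move=> a b; rewrite cmp orbC.
- by move=> a b c ab bc nab nbc; have [] := btw a b c ab bc nab nbc.
Qed.

End ComparabilityOrientation.

(** * Multiplicativity from the images of matrix units *)

Section Normalized.
Variables (F : fieldType) (n : nat) (le : rel 'I_n.+1).
Local Notation M := 'M[F]_n.+1.
Local Notation E := (@delta_mx F n.+1 n.+1).
Variables (theta : {linear M -> M}) (la : 'I_n.+1 -> 'I_n.+1).
Hypothesis la_inj : injective la.
Hypothesis theta_diag : forall i, theta (E i i) = E (la i) (la i).

(** The Jordan relation makes [c] multiplicative along chains, its second product vanishing because
    z differs from x. Thus [theta] relabels indices by [la] and twists entries by a cocycle, which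
    respects products. *)
Lemma mult_of_delta (c : 'I_n.+1 -> 'I_n.+1 -> F) :
  is_poset le ->
  (forall x y, le x y -> theta (E x y) = c x y *: E (la x) (la y)) ->
  (forall x y z, le x y -> le y z -> x != y -> y != z ->
    theta (E x y) * theta (E y z) + theta (E y z) * theta (E x y) = theta (E x z)) ->
  forall A B, incmx le A -> incmx le B -> theta (A * B) = theta A * theta B.
Proof.
move=> po theta_delta jordan.
have [refl anti tr] := po.
have c_diag x : c x x = 1.
  have := theta_diag x; rewrite theta_delta ?refl // => /matrixP/(_ (la x) (la x)).
  by rewrite !mxE !eqxx mulr1.
have c_cocycle x y z : le x y -> le y z -> c x y * c y z = c x z.
  have [<-|xy] := eqVneq x y; first by rewrite c_diag mul1r.
  have [<-|yz] := eqVneq y z; first by rewrite c_diag mulr1.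
  move=> le_xy le_yz; have le_xz := tr _ _ _ le_xy le_yz.
  have := jordan x y z le_xy le_yz xy yz; rewrite !theta_delta //.
  have zx : z != x.
    by apply: contra xy => /eqP zx; rewrite (anti x y) // le_xy -zx.
  rewrite -!scalerAl -!scalerAr !mul_deltas !(inj_eq la_inj) (negPf zx) eqxx.
  rewrite !scaler0 addr0 scalerA => /matrixP/(_ (la x) (la z)).
  by rewrite !mxE !eqxx !mulr1.
have [la' la'K laK] := injF_bij la_inj.
have entry A x y : incmx le A -> theta A (la x) (la y) = A x y * c x y.
  move=> hA; rewrite {1}(incmx_sum_delta hA) linear_sum summxE (bigD1 x) //=.
  rewrite [X in _ + X]big1 ?addr0 => [|i ix].
    rewrite linear_sum summxE; have [xy|/[dup] nxy /hA ->] := boolP (le x y); last first.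
      rewrite mul0r big1 // => j xj; rewrite linearZ /= theta_delta // !mxE.
      rewrite !(inj_eq la_inj); case: (eqVneq y j) => [yj|]; rewrite ?andbF ?mulr0 //.
      by rewrite yj xj in nxy.
    rewrite (bigD1 y) //= big1 ?addr0 => [|j /andP[xj jy]].
      by rewrite linearZ /= theta_delta // !mxE !eqxx mulr1.
    rewrite linearZ /= theta_delta // !mxE (inj_eq la_inj y) eq_sym.
    by rewrite (negPf jy) andbF !mulr0.
  rewrite linear_sum summxE big1 // => j ij.
  rewrite linearZ /= theta_delta // !mxE (inj_eq la_inj x) eq_sym.
  by rewrite (negPf ix) !mulr0.
move=> A B hA hB; apply/matrixP => a b.
rewrite -(laK a) -(laK b); move: (la' a) (la' b) => x y.
rewrite entry; last exact: incmxM.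
rewrite !mulmx_entry [RHS](reindex la) /=; last by exists la' => i _; rewrite ?la'K ?laK.
rewrite mulr_suml; apply: eq_bigr => l _; rewrite !entry //.
have [xl|/hA->] := boolP (le x l); last by rewrite !mul0r.
have [ly|/hB->] := boolP (le l y); last by rewrite !(mulr0, mul0r).
by rewrite -(c_cocycle x l y) // mulrACA.
Qed.
End Normalized.

(** * Idempotent preservers that permute the diagonal matrix units *)

Section NormalizedPreserver.
Variables (F : fieldType) (n : nat) (le : rel 'I_n.+1).
Local Notation M := 'M[F]_n.+1.
Local Notation E := (@delta_mx F n.+1 n.+1).
Variables (theta : {linear M -> M}) (la : 'I_n.+1 -> 'I_n.+1).
Hypotheses (two_neq0 : 2%:R != 0 :> F) (po : is_poset le).
Hypothesis theta_inc : forall A, incmx le A -> incmx le (theta A).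
Hypothesis theta_inj : forall A, incmx le A -> theta A = 0 -> A = 0.
Hypothesis theta_surj : forall B, incmx le B -> exists2 A, incmx le A & theta A = B.
Hypothesis theta_idem : forall A, incmx le A -> A * A = A ->
  theta A * theta A = theta A.
Hypothesis la_inj : injective la.
Hypothesis theta_diag : forall i, theta (E i i) = E (la i) (la i).

(** The two equations make A + B and A - B idempotent; [theta] preserves this, and the even and odd
    parts are separated again. All relations below come from choices of such pairs. *)
Lemma theta_idem_pair A B : incmx le A -> incmx le B ->
  A * A + B * B = A -> A * B + B * A = B ->
  theta A * theta A + theta B * theta B = theta A /\
  theta A * theta B + theta B * theta A = theta B.
Proof.
move=> hA hB hAB hBA; apply: (idem_addsub two_neq0).
  rewrite -!linearD /=; apply: theta_idem; first exact: incmxD.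
  rewrite !mulrDl !mulrDr [B * A + _]addrC addrACA hAB hBA //.
rewrite -!linearB /=; apply: theta_idem; first exact: incmxB.
rewrite !mulrDl !mulrDr !mulrN !mulNr opprK [- (B * A) + _]addrC addrACA -opprD.
by rewrite hAB hBA.
Qed.

Section Edge.
Variables x y : 'I_n.+1.
Hypotheses (xy : x != y) (le_xy : le x y).

(** The even part for the idempotents [E x x + E x y] and [E x x - E x y]. The odd part gives
    [edge_theta_source], and [E y y] in place of [E x x] gives [edge_theta_target]. *)
Lemma edge_theta_square : theta (E x y) * theta (E x y) = 0.
Proof.
case: po => refl _ _.
have [||||] := @theta_idem_pair (E x x) (E x y).
- exact: incmx_delta.
- exact: incmx_delta.
- by rewrite !mul_deltas eqxx eq_sym (negPf xy) addr0.
- by rewrite !mul_deltas eqxx eq_sym (negPf xy) addr0.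
rewrite theta_diag mul_deltas eqxx => h _.
by apply: (addrI (E (la x) (la x))); rewrite h addr0.
Qed.

Lemma edge_theta_source :
  E (la x) (la x) * theta (E x y) + theta (E x y) * E (la x) (la x) = theta (E x y).
Proof.
case: po => refl _ _.
have [||||] := @theta_idem_pair (E x x) (E x y).
- exact: incmx_delta.
- exact: incmx_delta.
- by rewrite !mul_deltas eqxx eq_sym (negPf xy) addr0.
- by rewrite !mul_deltas eqxx eq_sym (negPf xy) addr0.
by rewrite theta_diag.
Qed.

Lemma edge_theta_target :
  E (la y) (la y) * theta (E x y) + theta (E x y) * E (la y) (la y) = theta (E x y).
Proof.
case: po => refl _ _.
have [||||] := @theta_idem_pair (E y y) (E x y).
- exact: incmx_delta.
- exact: incmx_delta.
- by rewrite !mul_deltas eqxx eq_sym (negPf xy) addr0.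
- by rewrite !mul_deltas eqxx eq_sym (negPf xy) add0r.
by rewrite theta_diag.
Qed.

(** Adding or subtracting [E x y] from [E x x + E z z] gives idempotents; removing the relation at x
    leaves the one at z. *)
Lemma edge_theta_orth z : z != x -> z != y ->
  E (la z) (la z) * theta (E x y) + theta (E x y) * E (la z) (la z) = 0.
Proof.
move=> zx zy; case: po => refl _ _.
have [||||] := @theta_idem_pair (E x x + E z z) (E x y).
- by apply: incmxD; apply: incmx_delta.
- exact: incmx_delta.
- rewrite !(mulrDl, mulrDr) !mul_deltas !eqxx (negPf zx) [x == z]eq_sym (negPf zx).
  by rewrite eq_sym (negPf xy) !addr0 add0r.
- rewrite !(mulrDl, mulrDr) !mul_deltas !eqxx (negPf zx).
  by rewrite ![y == _]eq_sym (negPf xy) (negPf zy) !addr0.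
rewrite linearD /= !theta_diag => _.
rewrite mulrDl mulrDr addrACA edge_theta_source => h.
by apply: (addrI (theta (E x y))); rewrite h addr0.
Qed.

(** At a nonzero entry the source relation forces exactly one of a, b to be [la x]: with both the
    entry would be doubled, with none it would be zero. The target relation does the same for
    [la y]. *)
Lemma edge_theta_support a b : theta (E x y) a b != 0 ->
  (a = la x /\ b = la y) \/ (a = la y /\ b = la x).
Proof.
move=> ab; have one i : E (la i) (la i) * theta (E x y) +
    theta (E x y) * E (la i) (la i) = theta (E x y) -> (a == la i) (+) (b == la i).
  move/matrixP/(_ a b); rewrite mxE mul_delta_mxE mul_mx_deltaE.
  case: (eqVneq a (la i)) => [ea|_]; case: (eqVneq b (la i)) => [eb|_] //=.
    by rewrite -{1}ea -eb => /eqP; rewrite -subr_eq0 addrK (negPf ab).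
  by rewrite !mulr0n addr0 => /esym/eqP; rewrite (negPf ab).
have := one x edge_theta_source; have := one y edge_theta_target.
have nxy : la x != la y by rewrite (inj_eq la_inj).
have [->|ax] := eqVneq a (la x).
  by rewrite (negPf nxy) /= => /eqP ->; left.
move=> h /eqP bx; right; split=> //; apply/eqP.
by move: h; rewrite bx (negPf nxy) addbF.
Qed.

Lemma edge_theta_neq0 : exists a b, theta (E x y) a b != 0.
Proof.
have [/existsP[a /existsP[b ab]]|none] := boolP [exists a, exists b, theta (E x y) a b != 0].
  by exists a, b.
have /matrixP/(_ x y)/eqP : E x y = 0.
  apply: theta_inj; first exact: incmx_delta.
  apply/matrixP => a b; rewrite mxE; apply/eqP; apply: contraNT none => ab.
  by apply/existsP; exists a; apply/existsP; exists b.
by rewrite !mxE !eqxx oner_eq0.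
Qed.

Lemma edge_comparable : le (la x) (la y) || le (la y) (la x).
Proof.
have [a [b ab]] := edge_theta_neq0.
have : le a b by apply: contraR ab => /(theta_inc (incmx_delta _ le_xy)) ->.
by case: (edge_theta_support ab) => -[-> ->] ->; rewrite ?orbT.
Qed.

(** Of the two positions allowed by the support, the reversed one would put [la y] below [la x],
    against antisymmetry. *)
Lemma edge_theta_mono : le (la x) (la y) ->
  theta (E x y) = theta (E x y) (la x) (la y) *: E (la x) (la y).
Proof.
case: po => _ anti _ lexy; apply/matrixP => a b; rewrite !mxE.
case: (eqVneq a (la x)) => [->|ax].
  case: (eqVneq b (la y)) => [->|bx]; first by rewrite mulr1.
  rewrite mulr0; apply/eqP; apply: contraNT bx => /edge_theta_support[[_ -> //]|[]].
  by move/la_inj/eqP; rewrite (negPf xy).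
rewrite mulr0; apply/eqP; apply/negPn/negP => nz.
have [[ea _]|[ea eb]] := edge_theta_support nz; first by rewrite ea eqxx in ax.
have : le a b by apply: contraR nz => /(theta_inc (incmx_delta _ le_xy)) ->.
rewrite ea eb => leyx; move/eqP: ax; apply; rewrite ea; apply: anti.
by rewrite leyx lexy.
Qed.

Lemma edge_theta_anti : le (la y) (la x) ->
  theta (E x y) = theta (E x y) (la y) (la x) *: E (la y) (la x).
Proof.
case: po => _ anti _ leyx; apply/matrixP => a b; rewrite !mxE.
case: (eqVneq a (la y)) => [->|ay].
  case: (eqVneq b (la x)) => [->|bx]; first by rewrite mulr1.
  rewrite mulr0; apply/eqP; apply: contraNT bx => /edge_theta_support[[]|[_ -> //]].
  by move/la_inj/esym/eqP; rewrite (negPf xy).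
rewrite mulr0; apply/eqP; apply/negPn/negP => nz.
have [[ea eb]|[ea _]] := edge_theta_support nz; last by rewrite ea eqxx in ay.
have : le a b by apply: contraR nz => /(theta_inc (incmx_delta _ le_xy)) ->.
rewrite ea eb => lexy; move/eqP: ay; apply; rewrite ea; apply: anti.
by rewrite leyx lexy.
Qed.

End Edge.

Lemma theta_jordan x y z : le x y -> le y z -> x != y -> y != z ->
  theta (E x y) * theta (E y z) + theta (E y z) * theta (E x y) = theta (E x z).
Proof.
case: po => refl anti tr le_xy le_yz xy yz; have le_xz := tr _ _ _ le_xy le_yz.
have xz : x != z.
  by apply: contra xy => /eqP xz; rewrite (anti x y) // le_xy xz.
(* The sum and difference of this pair are the rank-one idempotents (e_y + e_x)(e_y + e_z)^T and
   (e_y - e_x)(e_y - e_z)^T. *)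
have [||||] := @theta_idem_pair (E y y + E x z) (E x y + E y z).
- by apply: incmxD; apply: incmx_delta.
- by apply: incmxD; apply: incmx_delta.
- rewrite !(mulrDl, mulrDr) !mul_deltas !eqxx [z == y]eq_sym [z == x]eq_sym.
  rewrite [y == x]eq_sym (negPf xy) (negPf yz) (negPf xz).
  by rewrite !(addr0, add0r).
- rewrite !(mulrDl, mulrDr) !mul_deltas !eqxx [z == y]eq_sym [z == x]eq_sym.
  rewrite [y == x]eq_sym (negPf xy) (negPf yz) (negPf xz).
  by rewrite !(addr0, add0r) addrC.
move=> + _; rewrite !linearD /= theta_diag.
rewrite !(mulrDl (E _ _ : M)) !(mulrDl (theta _)) !mulrDr mul_deltas eqxx.
rewrite !edge_theta_square // addr0 add0r addr0.
rewrite -[E _ _ + _ + _]addrA edge_theta_orth //; last by rewrite eq_sym.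
by rewrite addr0 => /addrI; rewrite addrC.
Qed.

(** By surjectivity the unit at ([la x], [la y]) is a combination of images of [E i j] with i below
    j, and by the support lemma only the pair {x, y} can contribute to that entry. *)
Lemma theta_reflects_comparable x y : le (la x) (la y) -> le x y || le y x.
Proof.
case: po => refl _ _ lexy; have [->|xy] := eqVneq x y; first by rewrite refl.
have [A hA thA] := theta_surj (incmx_delta _ lexy).
apply/negPn/negP => /norP[nxy nyx].
have /eqP : theta A (la x) (la y) = 1 by rewrite thA mxE !eqxx.
rewrite {1}(incmx_sum_delta hA) linear_sum summxE big1 ?[0 == _]eq_sym ?oner_eq0 //.
move=> i _; rewrite linear_sum summxE big1 // => j le_ij; rewrite linearZ mxE /=.
have [->|] := eqVneq (theta (E i j) (la x) (la y)) 0; first by rewrite mulr0.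
have [->|ij] := eqVneq i j.
  rewrite theta_diag mxE !(inj_eq la_inj).
  case: (eqVneq x j) => [ex|_]; last by rewrite eqxx.
  case: (eqVneq y j) => [ey|_]; last by rewrite eqxx.
  by rewrite ex ey eqxx in xy.
case/(edge_theta_support ij le_ij) => -[/la_inj ex /la_inj ey].
  by rewrite ex ey le_ij in nxy.
by rewrite ex ey le_ij in nyx.
Qed.

(** If [la y] lay above both other points or below both, the two matrix units would multiply to zero
    in either order, whereas their Jordan product is the nonzero [theta (E x z)]. *)
Lemma theta_between x y z : le x y -> le y z -> x != y -> y != z ->
  (le (la x) (la y) -> le (la y) (la z)) /\ (le (la y) (la x) -> le (la z) (la y)) /\
  (le (la y) (la z) -> le (la x) (la y)) /\ (le (la z) (la y) -> le (la y) (la x)).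
Proof.
case: po => _ anti tr le_xy le_yz xy yz; have le_xz := tr _ _ _ le_xy le_yz.
have xz : x != z.
  by apply: contra xy => /eqP xz; rewrite (anti x y) // le_xy xz.
have jordan := theta_jordan le_xy le_yz xy yz.
have [a [b nz]] := edge_theta_neq0 le_xz.
have no_peak : ~ (le (la x) (la y) /\ le (la z) (la y)).
  move=> [h1 h2]; move: jordan nz.
  rewrite (edge_theta_mono xy le_xy h1) (edge_theta_anti yz le_yz h2).
  rewrite -!scalerAl -!scalerAr !mul_deltas !(inj_eq la_inj) (negPf yz) eq_sym.
  by rewrite (negPf xy) !scaler0 addr0 => <-; rewrite mxE eqxx.
have no_valley : ~ (le (la y) (la x) /\ le (la y) (la z)).
  move=> [h1 h2]; move: jordan nz.
  rewrite (edge_theta_anti xy le_xy h1) (edge_theta_mono yz le_yz h2).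
  rewrite -!scalerAl -!scalerAr !mul_deltas !(inj_eq la_inj) (negPf xy) eq_sym.
  by rewrite (negPf yz) !scaler0 addr0 => <-; rewrite mxE eqxx.
have /orP c1 := edge_comparable xy le_xy; have /orP c2 := edge_comparable yz le_yz.
by split=> [h|]; [|split=> [h|]; [|split=> h]]; intuition.
Qed.

Theorem normalized_preserver : poset_connected le ->
  (forall A B, incmx le A -> incmx le B -> theta (A * B) = theta A * theta B) \/
  (forall A B, incmx le A -> incmx le B -> theta (A * B) = theta B * theta A).
Proof.
move=> conn; have [refl anti tr] := po.
pose le2 : rel 'I_n.+1 := fun x y => le (la x) (la y).
have po2 : is_poset le2.
  split; first by move=> x; apply: refl.
    by move=> x y /anti/la_inj.
  by move=> y x z; apply: tr.
have cmp a b : le a b || le b a = le2 a b || le2 b a.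
  have imp x y : le x y -> le2 x y || le2 y x.
    have [->|xy] := eqVneq x y; first by rewrite /le2 !refl.
    exact: edge_comparable.
  apply/idP/idP => /orP[]; rewrite /le2.
  - exact: imp.
  - by move/imp; rewrite orbC.
  - exact: theta_reflects_comparable.
  - by move/theta_reflects_comparable; rewrite orbC.
have btw : same_between le le2.
  move=> x y z le_xy le_yz xy yz.
  have [h1 [h2 [h3 h4]]] := theta_between le_xy le_yz xy yz.
  by split; apply/idP/idP.
have [mono|antimono] := mono_or_anti po po2 conn cmp btw; [left|right].
  apply: (mult_of_delta (le := le) la_inj theta_diag (c := fun x y => theta (E x y) (la x) (la y))) => //.
    move=> x y le_xy; have [<-|xy] := eqVneq x y; last by apply: edge_theta_mono => //; apply: mono.
    by rewrite theta_diag mxE !eqxx scale1r.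
  exact: theta_jordan.
(* Transposition turns the antitone case into the situation of [mult_of_delta]. *)
have diagT i : (trmx \o theta) (E i i) = E (la i) (la i) by rewrite /= theta_diag trmx_delta.
have trM (A B : M) : (A * B)^T = B^T * A^T by rewrite -mulmxE trmx_mul.
move=> A B hA hB; apply: trmx_inj; rewrite trM.
apply: (mult_of_delta (le := le) la_inj diagT (c := fun x y => theta (E x y) (la y) (la x))) => //.
  move=> x y le_xy; have [<-|xy] := eqVneq x y.
    by rewrite /= theta_diag trmx_delta mxE !eqxx scale1r.
  rewrite /= (edge_theta_anti xy le_xy (antimono _ _ le_xy)).
  by rewrite linearZ /= trmx_delta !mxE !eqxx mulr1.
move=> x y z le_xy le_yz xy yz /=.
by rewrite -!trM -linearD /= addrC theta_jordan.
Qed.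

End NormalizedPreserver.

(** * Normalizing an idempotent preserver by conjugation *)

(** Evaluating pqp in two ways gives both -pq and -qp, so p and q commute as well as anticommute. *)
Lemma idem_orth_of_anticomm (F : fieldType) (A : algType F) (p q : A) :
  2%:R != 0 :> F -> p * p = p -> q * p + p * q = 0 -> p * q = 0.
Proof.
move=> two_neq0 pp qp_pq; have pq : p * q = - (q * p).
  by apply/eqP; rewrite -addr_eq0 addrC qp_pq.
have qp : q * p = p * q.
  have h : p * (q * p) = - (p * q) by rewrite -[in RHS]pp -mulrA pq mulrN opprK.
  by rewrite pq -[in LHS]pp mulrA -[q * p]opprK -pq mulNr -mulrA h opprK pq.
by apply: (eq_of_double two_neq0); rewrite addr0 -{1}qp.
Qed.

Section IdempotentPreserver.
Variables (F : fieldType) (n : nat) (le : rel 'I_n.+1).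
Local Notation M := 'M[F]_n.+1.
Local Notation E := (@delta_mx F n.+1 n.+1).
Variables (Psi : {linear M -> M}).
Hypotheses (two_neq0 : 2%:R != 0 :> F) (po : is_poset le).
Hypothesis Psi_inc : forall A, incmx le A -> incmx le (Psi A).
Hypothesis Psi_inj : forall A, incmx le A -> Psi A = 0 -> A = 0.
Hypothesis Psi_surj : forall B, incmx le B -> exists2 A, incmx le A & Psi A = B.
Hypothesis Psi_idem : forall A, incmx le A -> A * A = A -> Psi A * Psi A = Psi A.

Let f i := Psi (E i i).

Let E_inc i : incmx le (E i i).
Proof. by apply: incmx_delta; case: po. Qed.

Let f_inc i : incmx le (f i). Proof. exact/Psi_inc/E_inc. Qed.

Let f_idem i : f i * f i = f i.
Proof. by apply: Psi_idem => //; rewrite mul_deltas eqxx. Qed.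

Let f_orth i j : i != j -> f i * f j = 0.
Proof.
move=> ij; apply: (idem_orth_of_anticomm two_neq0 (f_idem i)).
have : (f i + f j) * (f i + f j) = f i + f j.
  rewrite /f -linearD /=; apply: Psi_idem; first exact: incmxD.
  by rewrite !(mulrDl, mulrDr) !mul_deltas !eqxx [j == i]eq_sym (negPf ij) addr0 add0r.
rewrite !(mulrDl, mulrDr) !f_idem -addrA => /addrI.
by rewrite addrA => /eqP; rewrite -subr_eq0 addrK addrC => /eqP.
Qed.

(** A diagonal position where [f i] is nonzero; it exists because [f i] is a nonzero idempotent, to
    which [incmx_idem_diag0] applies. *)
Let la i := odflt i [pick x | f i x x != 0].

Let f_la i : f i (la i) (la i) = 1.
Proof.
have : f i (la i) (la i) != 0.
  rewrite /la; case: pickP => //= none.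
  have /matrixP/(_ i i)/eqP : E i i = 0.
    apply: Psi_inj => //; apply: (incmx_idem_diag0 po (f_inc i) (f_idem i)) => x.
    by apply/eqP/negPn; rewrite none.
  by rewrite !mxE eqxx oner_eq0.
move=> nz; apply: (mulfI nz); rewrite mulr1 -[in RHS]f_idem.
by rewrite (incmx_mul_diag po).
Qed.

(** At a common position two orthogonal idempotents would both have diagonal entry 1, and so would
    their product. *)
Let la_inj : injective la.
Proof.
move=> i j ij; apply/eqP; apply/negPn/negP => /f_orth/matrixP/(_ (la i) (la i)).
rewrite (incmx_mul_diag po) // f_la {1 2}ij f_la mxE mul1r => /eqP.
by rewrite oner_eq0.
Qed.

(* [h] and [g] are mutually inverse and conjugate [f i] to [E (la i) (la i)]. *)
Let h := \sum_i E (la i) (la i) * f i.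
Let g := \sum_i f i * E (la i) (la i).

Let corner i : E (la i) (la i) * f i * E (la i) (la i) = E (la i) (la i).
Proof.
apply/matrixP => a b; rewrite mul_mx_deltaE mul_delta_mxE mxE.
by rewrite f_la; case: (a == la i); case: (b == la i).
Qed.

Let h_f i : h * f i = E (la i) (la i) * f i.
Proof.
rewrite /h mulr_suml (bigD1 i) //= big1 ?addr0 -?mulrA ?f_idem // => j ji.
by rewrite -mulrA f_orth ?mulr0.
Qed.

Let f_g i : f i * g = f i * E (la i) (la i).
Proof.
rewrite /g mulr_sumr (bigD1 i) //= big1 ?addr0 ?mulrA ?f_idem // => j ji.
by rewrite mulrA f_orth ?mul0r // eq_sym.
Qed.

Let hg : h * g = 1.
Proof.
rewrite /g mulr_sumr.
under eq_bigr do rewrite mulrA h_f corner.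
have [la' la'K laK] := injF_bij la_inj.
rewrite [RHS]mx1_sum_delta [RHS](reindex la) //.
by exists la' => i _; rewrite ?la'K ?laK.
Qed.

Let gh : g * h = 1. Proof. by rewrite -mulmxE; apply: mulmx1C; rewrite mulmxE hg. Qed.

Theorem idempotent_preserver : poset_connected le ->
  (forall A B, incmx le A -> incmx le B -> Psi (A * B) = Psi A * Psi B) \/
  (forall A B, incmx le A -> incmx le B -> Psi (A * B) = Psi B * Psi A).
Proof.
(* The conjugate by [h] sends [E i i] to the corner [E (la i) (la i)], and stays inside the
   incidence matrices because [h] and [g] lie there. *)
pose theta : {linear M -> M} := mulmxr g \o mulmx h \o Psi.
have thetaE A : theta A = h * Psi A * g by [].
have h_inc : incmx le h by apply: incmx_sum => i; apply: incmxM.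
have g_inc : incmx le g by apply: incmx_sum => i; apply: incmxM.
have PsiE A : Psi A = g * theta A * h.
  by rewrite thetaE !mulrA gh mul1r -mulrA gh mulr1.
have thetaM A B : theta A * theta B = h * (Psi A * Psi B) * g.
  by rewrite !thetaE !mulrA -[_ * g * h]mulrA gh mulr1.
move=> conn.
have [||||||hom|hom] := @normalized_preserver F n le theta la two_neq0 po _ _ _ _ _ _ conn.
- by move=> A hA; rewrite thetaE; do 2!apply: incmxM => //; apply: Psi_inc.
- by move=> A hA thA; apply: Psi_inj => //; rewrite PsiE thA mulr0 mul0r.
- move=> B hB; have [|A hA PA] := Psi_surj (B := g * B * h).
    by do 2!apply: incmxM => //.
  by exists A => //; rewrite thetaE PA !mulrA hg mul1r -mulrA hg mulr1.
- by move=> A hA idA; rewrite thetaM Psi_idem.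
- exact: la_inj.
- by move=> i; rewrite thetaE -/(f i) h_f -mulrA f_g mulrA corner.
- left=> A B hA hB; rewrite PsiE hom // thetaM !mulrA gh mul1r.
  by rewrite -mulrA gh mulr1.
- right=> A B hA hB; rewrite PsiE hom // thetaM !mulrA gh mul1r.
  by rewrite -mulrA gh mulr1.
Qed.

End IdempotentPreserver.

(** * Preservers of k-potent incidence matrices *)

Lemma exprD_orth_idem (F : fieldType) (A : algType F) (e f : A) (t : F) m :
  e * e = e -> f * f = f -> e * f = 0 -> f * e = 0 ->
  (e + t *: f) ^+ m.+1 = e + t ^+ m.+1 *: f.
Proof.
move=> ee ff ef fe; elim: m => [|m IH]; first by rewrite !expr1.
rewrite exprS IH mulrDl !mulrDr ee -!scalerAr -!scalerAl ef fe ff !scaler0.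
by rewrite addr0 add0r scalerA -exprSr.
Qed.

Section KPotentPreserver.
Variables (F : fieldType) (n : nat) (le : rel 'I_n.+1) (k : nat) (w : F).
Local Notation M := 'M[F]_n.+1.
Local Notation E := (@delta_mx F n.+1 n.+1).
Variables (Phi : {linear M -> M}).
Hypotheses (k_ge3 : (3 <= k)%N) (prim_w : k.-1.-primitive_root w).
Hypothesis k_neq0 : k%:R != 0 :> F.
Hypotheses (po : is_poset le) (conn : poset_connected le).
Hypothesis Phi_inc : forall A, incmx le A -> incmx le (Phi A).
Hypothesis Phi_inj : forall A, incmx le A -> Phi A = 0 -> A = 0.
Hypothesis Phi_surj : forall B, incmx le B -> exists2 A, incmx le A & Phi A = B.
Hypothesis Phi_kpot : forall A, incmx le A -> A ^+ k = A -> Phi A ^+ k = Phi A.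

Let expr_k t : t ^+ k.-1 = 1 -> t ^+ k = t :> F.
Proof. by case: k k_ge3 => // m _ /= tm; rewrite exprS tm mulr1. Qed.

(** Both k and k - 1 are nonzero in F, the latter by the primitive root, and one of them is even. *)
Lemma kpotent_two_neq0 : 2%:R != 0 :> F.
Proof.
have k1_neq0 := prim_root_natf_neq0 prim_w.
apply/negP => /eqP two0; have odd0 m : ~~ odd m -> m%:R = 0 :> F.
  by rewrite -(dvdn2 m) => /dvdnP[q ->]; rewrite natrM two0 mulr0.
case: k k_ge3 k_neq0 k1_neq0 => // m _ /=; case: (boolP (odd m)) => om.
  by rewrite (odd0 m.+1) ?eqxx //= om.
by rewrite (odd0 m) ?eqxx.
Qed.

Lemma Phi_idem_mul1 e : incmx le e -> e * e = e ->
  Phi e * Phi 1 = Phi e * Phi e /\ Phi 1 * Phi e = Phi e * Phi e.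
Proof.
move=> he ee; pose e' := 1 - e; have he' : incmx le e' by apply: incmxB => //; apply: incmx1.
have ee' : e * e' = 0 by rewrite mulrBr ee mulr1 subrr.
have e'e : e' * e = 0 by rewrite mulrBl ee mul1r subrr.
have e'e' : e' * e' = e' by rewrite {1}/e' mulrBl ee' mul1r subr0.
have [k' k'E] : exists k', k = k'.+1 by case: k k_ge3 => // k'; exists k'.
have idem_k x : x * x = x -> x ^+ k = x :> M.
  by move=> xx; rewrite k'E; elim: k' {k'E} => // m IH; rewrite exprS IH.
have [||t t1|h1 h2] := kpotent_pencil_mul0 (a := Phi e) (b := Phi e') k_ge3 prim_w k_neq0.
- by apply: Phi_kpot => //; apply: idem_k.
- by apply: Phi_kpot => //; apply: idem_k.
- rewrite -linearZ -linearD; apply: Phi_kpot.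
    by apply: incmxD => //; apply: incmxZ.
  by rewrite {1}k'E exprD_orth_idem // -k'E expr_k.
move: h1 h2; rewrite linearB /= mulrBr mulrBl.
by move=> /eqP; rewrite subr_eq0 => /eqP-> /eqP; rewrite subr_eq0 => /eqP->.
Qed.

Lemma Phi1_central B : incmx le B -> Phi 1 * B = B * Phi 1.
Proof.
case: po => refl _ _ hB; have [A hA <-] := Phi_surj hB.
have idem_comm e : incmx le e -> e * e = e -> Phi 1 * Phi e = Phi e * Phi 1.
  by move=> he /(Phi_idem_mul1 he)[-> ->].
have diag_comm i : Phi 1 * Phi (E i i) = Phi (E i i) * Phi 1.
  by apply: idem_comm; [apply: incmx_delta | rewrite mul_deltas eqxx].
rewrite (incmx_sum_delta hA) !linear_sum mulr_sumr mulr_suml.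
apply: eq_bigr => i _; rewrite !linear_sum mulr_sumr mulr_suml.
apply: eq_bigr => j le_ij; rewrite linearZ /= -scalerAl -scalerAr; congr (_ *: _).
have [<-//|ij] := eqVneq i j.
(* An off-diagonal unit is the difference of the idempotents [E i i + E i j] and [E i i]. *)
have : Phi 1 * Phi (E i i + E i j) = Phi (E i i + E i j) * Phi 1.
  apply: idem_comm; first by apply: incmxD; apply: incmx_delta.
  rewrite !(mulrDl, mulrDr) !mul_deltas !eqxx eq_sym (negPf ij).
  by rewrite !addr0.
by rewrite linearD /= mulrDl mulrDr diag_comm => /addrI.
Qed.

(** Commuting with [E j j] kills the off-diagonal entries of column j; commuting with [E x y]
    equates the diagonal entries at x and y, and connectedness carries the value at 0 to every
    index. *)
Lemma incmx_central_scalar c : (forall B : M, incmx le B -> c * B = B * c) ->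
  c = c 0 0 *: 1.
Proof.
case: po => refl _ _ cc; apply/matrixP => i j; rewrite !mxE.
have [<-|ij] := eqVneq i j; last first.
  have /matrixP/(_ i j) := cc _ (incmx_delta _ (refl j)).
  by rewrite mul_mx_deltaE mul_delta_mxE eqxx (negPf ij) mulr0.
rewrite mulr1; have /connectP[p] := conn 0 i.
elim: p (0 : 'I_n.+1) => [|b p IH] a /=; first by move=> _ ->.
case/andP=> ab pp lp; rewrite (IH b) //.
have le_eq x y : le x y -> c x x = c y y.
  move=> le_xy; have /matrixP/(_ x y) := cc _ (incmx_delta _ le_xy).
  by rewrite mul_mx_deltaE mul_delta_mxE !eqxx.
by case/orP: ab => /le_eq ->.
Qed.

Theorem kpotent_preserver : exists r : F, [/\ r ^+ k.-1 = 1, Phi 1 = r *: 1 &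
  (forall A B, incmx le A -> incmx le B -> r *: Phi (A * B) = Phi A * Phi B) \/
  (forall A B, incmx le A -> incmx le B -> r *: Phi (A * B) = Phi B * Phi A)].
Proof.
set r := Phi 1 0 0; have Phi1 : Phi 1 = r *: 1 := incmx_central_scalar Phi1_central.
have r_neq0 : r != 0.
  apply: contraNneq (oner_neq0 M) => r0; apply/eqP.
  by apply: Phi_inj; rewrite ?Phi1 ?r0 ?scale0r //; apply: incmx1.
have rk : r ^+ k.-1 = 1.
  have /matrixP/(_ 0 0) : Phi 1 ^+ k = Phi 1.
    by apply: Phi_kpot; [apply: incmx1 | rewrite expr1n].
  rewrite Phi1 exprZn expr1n !mxE !mulr1; case: k k_ge3 => // m _.
  by rewrite exprS -{3}[r]mulr1 => /(mulfI r_neq0).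
exists r; split=> //.
pose Psi : {linear M -> M} := r^-1 \*: Phi.
have PhiE A : Phi A = r *: Psi A by rewrite /= scalerA mulfV // scale1r.
have [||||hom|hom] := @idempotent_preserver F n le Psi kpotent_two_neq0 po _ _ _ _ conn.
- by move=> A hA; apply: incmxZ; apply: Phi_inc.
- by move=> A hA PA; apply: Phi_inj => //; rewrite PhiE PA scaler0.
- move=> B hB; have [A hA PA] := Phi_surj (incmxZ r hB).
  by exists A => //=; rewrite PA scalerA mulVf // scale1r.
(* On idempotents the square of [Phi A] is [Phi A * Phi 1], that is r times [Phi A], so dividing by
   r restores idempotence. *)
- move=> A hA idA; have [/esym PA _] := Phi_idem_mul1 hA idA.
  rewrite /= -scalerAl -scalerAr PA Phi1 -scalerAr mulr1.
  by rewrite (scalerA _ r) mulVf // scale1r.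
- left=> A B hA hB; move: (Psi) PhiE hom => P PhiE hom.
  by rewrite !PhiE hom // -scalerAl -scalerAr.
- right=> A B hA hB; move: (Psi) PhiE hom => P PhiE hom.
  by rewrite !PhiE hom // -scalerAl -scalerAr.
Qed.

End KPotentPreserver.

(** * Transport between functions on the poset and matrices *)

Section Transport.
Variables (F : fieldType) (T : finType) (le : rel T) (n : nat).
Variables (e : 'I_n.+1 -> T) (e' : T -> 'I_n.+1).
Hypotheses (eK : cancel e e') (e'K : cancel e' e) (po : is_poset le).
Local Notation M := 'M[F]_n.+1.
Implicit Types f g : {ffun T * T -> F}.

Definition ord_le : rel 'I_n.+1 := fun i j => le (e i) (e j).

Definition mx_of f : M := \matrix_(i, j) f (e i, e j).

Definition of_mx (A : M) : {ffun T * T -> F} := [ffun p => A (e' p.1) (e' p.2)].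

Lemma mx_ofK : cancel mx_of of_mx.
Proof. by move=> f; apply/ffunP => -[x y]; rewrite ffunE mxE /= !e'K. Qed.

Lemma of_mxK : cancel of_mx mx_of.
Proof. by move=> A; apply/matrixP => i j; rewrite mxE ffunE /= !eK. Qed.

Lemma incmx_mx_of f : incid le f <-> incmx ord_le (mx_of f).
Proof.
split=> [/forallP hf i j nle | hf].
  by rewrite mxE; have /forallP/(_ (e j))/implyP/(_ nle)/eqP := hf (e i).
apply/forallP => x; apply/forallP => y; apply/implyP => nle.
by have := hf (e' x) (e' y); rewrite /ord_le mxE !e'K => /(_ nle) ->.
Qed.

Lemma mx_of_lin a f g : mx_of (iscale a f + g) = a *: mx_of f + mx_of g.
Proof. by apply/matrixP => i j; rewrite !mxE !ffunE. Qed.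

Lemma mx_of_scale a f : mx_of (iscale a f) = a *: mx_of f.
Proof. by apply/matrixP => i j; rewrite !mxE !ffunE. Qed.

Lemma mx_of1 : mx_of (ione T F) = 1.
Proof.
by apply/matrixP => i j; rewrite !mxE ffunE /= (inj_eq (can_inj eK)).
Qed.

Lemma mx_ofM f g : incid le f -> incid le g ->
  mx_of (imul le f g) = mx_of f * mx_of g.
Proof.
move=> hf hg; apply/matrixP => i j.
rewrite mulmx_entry mxE ffunE /= big_mkcond (reindex e) /=; last first.
  by exists e' => x _; rewrite ?eK ?e'K.
apply: eq_bigr => l _; rewrite !mxE; case: ifPn => //.
rewrite negb_and => /orP[] nle.
  have /incmx_mx_of/(_ i l nle) := hf; rewrite mxE => ->.
  by rewrite mul0r.
have /incmx_mx_of/(_ l j nle) := hg; rewrite mxE => ->.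
by rewrite mulr0.
Qed.

Lemma incidM f g : incid le f -> incid le g -> incid le (imul le f g).
Proof.
case: po => _ _ tr /forallP hf /forallP hg.
apply/forallP => x; apply/forallP => y; apply/implyP => nle.
rewrite ffunE big1 //= => z /andP[xz zy]; by rewrite (tr _ _ _ xz zy) in nle.
Qed.

Lemma incid1 : incid le (ione T F).
Proof.
case: po => refl _ _; apply/forallP => x; apply/forallP => y; apply/implyP.
by rewrite ffunE /=; case: (eqVneq x y) => [->|_]; rewrite ?refl ?eqxx.
Qed.

Lemma mx_ofX f k : incid le f -> incid le (ipow le f k) /\
  mx_of (ipow le f k) = mx_of f ^+ k.
Proof.
move=> hf; elim: k => [|k [IH1 IH2]]; first by rewrite mx_of1; split=> //; apply: incid1.
by rewrite /ipow iterS -/(ipow le f k) mx_ofM // exprS IH2; split=> //; apply: incidM.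
Qed.

Lemma kpotent_mx_of k f : kpotent le k f <-> incmx ord_le (mx_of f) /\ mx_of f ^+ k = mx_of f.
Proof.
split=> [/andP[hf /eqP fk] | [/incmx_mx_of hf fk]].
  split; first exact/incmx_mx_of.
  by have [_ <-] := mx_ofX k hf; rewrite fk.
rewrite /kpotent hf /=; apply/eqP/(can_inj mx_ofK).
by have [_ ->] := mx_ofX k hf.
Qed.

Lemma ord_le_poset : is_poset ord_le.
Proof.
case: po => refl anti tr; split; first by move=> i; apply: refl.
  by move=> i j /anti/(can_inj eK).
by move=> j i l; apply: tr.
Qed.

Lemma ord_le_connected : poset_connected le -> poset_connected ord_le.
Proof.
move=> conn i j; have /connectP[p] := conn (e i) (e j).
elim: p i => [|x p IH] i /=; first by move=> _ /(can_inj eK) ->; apply: connect0.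
case/andP=> ix; rewrite -(e'K x) in ix * => px lp.
by apply: connect_trans (IH _ px lp); apply: connect1.
Qed.

(** Linearity of [phi] is known only on incidence functions; truncating first extends it to a linear
    map on all matrices. *)
Definition cut_mx (A : M) : M := \matrix_(i, j) (A i j *+ ord_le i j).

Lemma cut_mx_id A : incmx ord_le A -> cut_mx A = A.
Proof.
move=> hA; apply/matrixP => i j; rewrite mxE.
by case: (boolP (ord_le i j)) => // /hA ->.
Qed.

Lemma cut_mx_inc A : incmx ord_le (cut_mx A).
Proof. by move=> i j nle; rewrite mxE (negPf nle). Qed.

Lemma incid_of_mx A : incmx ord_le A -> incid le (of_mx A).
Proof. by move=> hA; apply/incmx_mx_of; rewrite of_mxK. Qed.

Variable phi : {ffun T * T -> F} -> {ffun T * T -> F}.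

Definition mx_map (A : M) : M := mx_of (phi (of_mx (cut_mx A))).

Lemma mx_map_of f : incid le f -> mx_map (mx_of f) = mx_of (phi f).
Proof. by move=> /incmx_mx_of hf; rewrite /mx_map cut_mx_id // mx_ofK. Qed.

Lemma mx_map_linear : ilinear le phi -> linear mx_map.
Proof.
case=> _ lin a A B.
have cutP (C : M) := incid_of_mx (cut_mx_inc C).
rewrite /mx_map -mx_of_lin -lin //; congr (mx_of (phi _)).
apply: (can_inj mx_ofK); rewrite mx_of_lin !of_mxK.
by apply/matrixP => i j; rewrite !mxE mulrnDl mulrnAr.
Qed.

Lemma incidence_kpotent_preserver k (w : F) : (3 <= k)%N ->
  k.-1.-primitive_root w -> k%:R != 0 :> F -> poset_connected le ->
  ilinear le phi -> ibijective le phi ->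
  (forall f, kpotent le k f -> kpotent le k (phi f)) ->
  exists r, [/\ r ^+ k.-1 = 1, phi (ione T F) = iscale r (ione T F) &
    (forall f g, incid le f -> incid le g ->
      iscale r (phi (imul le f g)) = imul le (phi f) (phi g)) \/
    (forall f g, incid le f -> incid le g ->
      iscale r (phi (imul le f g)) = imul le (phi g) (phi f))].
Proof.
move=> k_ge3 prim_w k_neq0 conn /[dup] lin [phi_inc _] [phi_inj phi_surj] phi_kpot.
pose Phi : {linear M -> M} := HB.pack mx_map
  (GRing.isLinear.Build F M M *:%R mx_map (mx_map_linear lin)).
have PhiE f : incid le f -> Phi (mx_of f) = mx_of (phi f) by apply: mx_map_of.
have mx_ofP A : incmx ord_le A -> exists2 f, incid le f & A = mx_of f.
  by move=> hA; exists (of_mx A); [apply: incid_of_mx | rewrite of_mxK].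
(* Turns injectivity on pairs into triviality of the kernel. *)
have phi0 : phi 0 = 0.
  apply: (can_inj mx_ofK); rewrite -PhiE; last first.
    by apply/incmx_mx_of => i j _; rewrite mxE ffunE.
  by rewrite (_ : mx_of 0 = 0) ?linear0 //; apply/matrixP => i j; rewrite !mxE ffunE.
have [||||||r [rk Phi1 hom]] := @kpotent_preserver F n ord_le k w Phi k_ge3 prim_w k_neq0.
- exact: ord_le_poset.
- exact: ord_le_connected.
- by move=> A /mx_ofP[f hf ->]; rewrite PhiE //; apply/incmx_mx_of/phi_inc.
- move=> A /mx_ofP[f hf ->]; rewrite PhiE // => phif0.
  have -> : f = 0.
    apply: phi_inj => //; first by apply/forallP => x; apply/forallP => y; rewrite ffunE eqxx implybT.
    rewrite phi0; apply: (can_inj mx_ofK); rewrite phif0.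
    by apply/matrixP => i j; rewrite !mxE ffunE.
  by apply/matrixP => i j; rewrite !mxE ffunE.
- move=> B /mx_ofP[g hg ->]; have [f hf <-] := phi_surj g hg.
  by exists (mx_of f); [apply/incmx_mx_of | rewrite PhiE].
- move=> A hA Ak; have [f hf Af] := mx_ofP A hA; rewrite Af PhiE //.
  have /phi_kpot/kpotent_mx_of[] // : kpotent le k f.
  by apply/kpotent_mx_of; rewrite -Af.
exists r; split=> //.
  by apply: (can_inj mx_ofK); rewrite -PhiE ?mx_of_scale ?mx_of1 //; apply: incid1.
case: hom => hom; [left|right] => f g hf hg; apply: (can_inj mx_ofK);
  rewrite mx_of_scale -PhiE ?mx_ofM ?hom ?PhiE //;
  by [apply: phi_inc | apply: incidM | apply/incmx_mx_of].
Qed.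

End Transport.

(** * Division by the scalar in the incidence algebra *)

Theorem theorem7p6 (k : nat) (T : finType) (le : rel T) (F : fieldType)
  (phi : {ffun T * T -> F} -> {ffun T * T -> F}) :
  (3 <= k)%N ->
  is_poset le -> poset_connected le ->
  (exists w : F, (k.-1).-primitive_root w) ->
  (k%:R != 0 :> F) ->
  ilinear le phi -> ibijective le phi ->
  (forall f, kpotent le k f -> kpotent le k (phi f)) ->
  exists (r : F) (psi : {ffun T * T -> F} -> {ffun T * T -> F}),
    [/\ r ^+ k.-1 = 1,
        iautomorphism le psi \/ iantiautomorphism le psi &
        forall f, incid le f -> phi f = iscale r (psi f)].
Proof.
move=> k_ge3 po conn [w prim_w] k_neq0 lin bij phi_kpot.
have [phi_inc phi_lin] := lin; have [phi_inj phi_surj] := bij.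
have scaleM (a b : F) (f : {ffun T * T -> F}) : iscale a (iscale b f) = iscale (a * b) f.
  by apply/ffunP => p; rewrite !ffunE mulrA.
have scale1 (f : {ffun T * T -> F}) : iscale 1 f = f.
  by apply/ffunP => p; rewrite ffunE mul1r.
have mulscale (a b : F) (f g : {ffun T * T -> F}) :
    imul le (iscale a f) (iscale b g) = iscale (a * b) (imul le f g).
  apply/ffunP => p; rewrite !ffunE mulr_sumr; apply: eq_bigr => z _.
  by rewrite !ffunE mulrACA.
have inc_scale (a : F) (f : {ffun T * T -> F}) : incid le f -> incid le (iscale a f).
  move=> /forallP hf; apply/forallP => x; apply/forallP => y; apply/implyP => nle.
  by have /forallP/(_ y)/implyP/(_ nle)/eqP := hf x; rewrite ffunE => ->; rewrite mulr0.
have [r [rk phi1 hom]] : exists r, [/\ r ^+ k.-1 = 1, phi (ione T F) = iscale r (ione T F) &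
    (forall f g, incid le f -> incid le g ->
      iscale r (phi (imul le f g)) = imul le (phi f) (phi g)) \/
    (forall f g, incid le f -> incid le g ->
      iscale r (phi (imul le f g)) = imul le (phi g) (phi f))].
  (* The matrices have size [n.+1], so the empty poset is treated apart: there all functions
     coincide and r = 1 works. *)
  case: (posnP #|T|) => [T0 | T_gt0].
    have empty (f g : {ffun T * T -> F}) : f = g.
      by apply/ffunP => p; have := fintype0 p.1 T0.
    by exists 1; split; [apply: expr1n | apply: empty | left=> *; apply: empty].
  have cardT : #|T| = #|T|.-1.+1 by rewrite prednK.
  pose e (i : 'I_(#|T|.-1.+1)) : T := enum_val (cast_ord (esym cardT) i).
  pose e' (x : T) : 'I_(#|T|.-1.+1) := cast_ord cardT (enum_rank x).
  have eK : cancel e e' by move=> i; rewrite /e /e' enum_valK cast_ordKV.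
  have e'K : cancel e' e by move=> x; rewrite /e /e' cast_ordK enum_rankK.
  exact: (incidence_kpotent_preserver eK e'K po k_ge3 prim_w).
have r_neq0 : r != 0.
  apply/eqP => r0; move: rk; rewrite r0 expr0n.
  (* The exponent is positive, so the power of 0 is 0 and not the empty product 1. *)
  have -> : (k.-1 == 0)%N = false by case: (k) k_ge3 => [|[|]].
  by move/esym/eqP; rewrite oner_eq0.
pose psi f := iscale r^-1 (phi f).
have phiE f : phi f = iscale r (psi f) by rewrite /psi scaleM mulfV.
have psi_lin : ilinear le psi.
  split=> [f hf | a f g hf hg]; first exact/inc_scale/phi_inc.
  rewrite /psi phi_lin //; apply/ffunP => p; rewrite !ffunE mulrDr.
  by rewrite mulrCA.
have psi_bij : ibijective le psi.
  split=> [f g hf hg eq_psi | g hg].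
    by apply: phi_inj => //; rewrite !phiE eq_psi.
  have [f hf phif] := phi_surj _ (inc_scale r g hg).
  by exists f; rewrite // /psi phif scaleM mulVf.
have psi1 : psi (ione T F) = ione T F by rewrite /psi phi1 scaleM mulVf.
(* Splits off two factors [r^-1], one for each factor of a product. *)
have psiM f : psi f = iscale (r^-1 * r^-1) (iscale r (phi f)).
  by rewrite scaleM mulfVK.
exists r, psi; split=> //.
case: hom => hom; [left|right]; split=> // f g hf hg.
  by rewrite psiM hom // -mulscale.
by rewrite psiM hom // -mulscale.
Qed.
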